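(* Let $t$ be an indeterminate and let $f(t)\in\mathbb{Z}[t^{\pm1}]$ be invertible. For $n\geq 2$ let $\eta_2:T_n\rightarrow\mathrm{GL}_n(\mathbb{Z}[t^{\pm1}])$ be the representation of the twin group $T_n$ given, for $1\leq i\leq n-1$, by $$\eta_2(s_i)=\left(\begin{array}{c|c|c} I_{i-1} & 0 & 0\\ \hline 0 & \begin{matrix}0 & f(t)\\ f(t)^{-1} & 0\end{matrix} & 0\\ \hline 0&0&I_{n-i-1}\end{array}\right).$$ Then $\eta_2$ is faithful (injective) for $n=2$ and unfaithful (not injective) for all $n\geq 3$.
   Context: For $n\geq 2$, the twin group $T_n$ is the group with generators $s_1,\ldots,s_{n-1}$ and defining relations $s_i^2=1$ for $1\leq i\leq n-1$, and $s_is_j=s_js_i$ for $|i-j|\geq 2$. $I_r$ is the $r\times r$ identity matrix. *)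

(* Defs.v *)
From HB Require Import structures.
From mathcomp Require Import all_boot all_order all_algebra.
From mathcomp Require Import perm zify boolp.

Set Implicit Arguments.
Unset Strict Implicit.
Unset Printing Implicit Defensive.

Import GRing.Theory.

Local Open Scope quotient_scope.

(* The letter [(i, false)] stands for the generator [x_i] and [(i, true)] for
   its formal inverse. *)
Definition gword (I : Type) := seq (I * bool).

(* The least congruence on words that contains the free cancellations and the
   defining relations. *)
Inductive gword_eq (I : Type) (rel : gword I -> gword I -> Prop) :
    gword I -> gword I -> Prop :=
| gword_eq_refl u : gword_eq rel u u
| gword_eq_sym u v : gword_eq rel u v -> gword_eq rel v u
| gword_eq_trans u v w :
    gword_eq rel u v -> gword_eq rel v w -> gword_eq rel u w
| gword_eq_cat u u' v v' : gword_eq rel u u' -> gword_eq rel v v' ->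
    gword_eq rel (u ++ v) (u' ++ v')
| gword_eq_cancel i b : gword_eq rel [:: (i, b); (i, ~~ b)] [::]
| gword_eq_rel u v : rel u v -> gword_eq rel u v.

Definition gword_inv (I : Type) (u : gword I) : gword I :=
  rev [seq (a.1, ~~ a.2) | a <- u].

Definition gword_eval (I : Type) (G : groupType) (g : I -> G) (u : gword I) :=
  (\prod_(a <- u) (if a.2 then (g a.1)^-1 else g a.1))%g.

Section Presentation.

Variables (I : choiceType) (rel : gword I -> gword I -> Prop).

Definition gword_eqb (u v : gword I) : bool := `[< gword_eq rel u v >].

Lemma gword_eqb_refl : reflexive gword_eqb.
Proof. by move=> u; apply/asboolP; constructor. Qed.

Lemma gword_eqb_sym : symmetric gword_eqb.
Proof.
by move=> u v; apply/asboolP/asboolP => ?; apply: gword_eq_sym.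
Qed.

Lemma gword_eqb_trans : transitive gword_eqb.
Proof.
move=> v u w /asboolP uv /asboolP vw; apply/asboolP.
exact: gword_eq_trans uv vw.
Qed.

Canonical gword_equiv :=
  EquivRel gword_eqb gword_eqb_refl gword_eqb_sym gword_eqb_trans.

Definition presented := {eq_quot gword_equiv}.
HB.instance Definition _ := Choice.on presented.
HB.instance Definition _ := EqQuotient.on presented.

Definition pclass (u : gword I) : presented := \pi_presented u.

Lemma pclassP u v : pclass u = pclass v <-> gword_eq rel u v.
Proof.
split; first by move/eqmodP/asboolP.
by move=> uv; apply/eqmodP/asboolP.
Qed.

Lemma pclass_repr x : pclass (repr x) = x.
Proof. exact: reprK. Qed.

Lemma repr_pclass u : gword_eq rel (repr (pclass u)) u.
Proof. by apply/pclassP; rewrite pclass_repr. Qed.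

Lemma gword_eq_invr u : gword_eq rel (u ++ gword_inv u) [::].
Proof.
elim: u => [|[i b] u IHu]; first exact: gword_eq_refl.
rewrite /gword_inv /= rev_cons -/(gword_inv u) -cats1.
apply: gword_eq_trans (gword_eq_cancel rel i b).
rewrite -[_ :: _]/([:: (i, b)] ++ _) -[[:: _; _]]/([:: (i, b)] ++ _).
apply: gword_eq_cat; first exact: gword_eq_refl.
by rewrite catA -[in X in gword_eq _ _ X](cat0s [:: _]);
   apply: gword_eq_cat IHu (gword_eq_refl _ _).
Qed.

Lemma gword_invK : involutive (@gword_inv I).
Proof.
move=> u; rewrite /gword_inv map_rev revK -map_comp -[RHS]map_id.
by apply: eq_map => -[i b] /=; rewrite negbK.
Qed.

Lemma gword_eq_invl u : gword_eq rel (gword_inv u ++ u) [::].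
Proof. by have := gword_eq_invr (gword_inv u); rewrite gword_invK. Qed.

Lemma gword_inv_cat u v :
  gword_inv (u ++ v) = gword_inv v ++ gword_inv u :> gword I.
Proof. by rewrite /gword_inv map_cat rev_cat. Qed.

Definition pone : presented := pclass [::].
Definition pmul (x y : presented) : presented := pclass (repr x ++ repr y).
Definition pinv (x : presented) : presented := pclass (gword_inv (repr x)).

Lemma pmulE u v : pmul (pclass u) (pclass v) = pclass (u ++ v).
Proof. by apply/pclassP; apply: gword_eq_cat; apply: repr_pclass. Qed.

Lemma pmulA : associative pmul.
Proof.
move=> x y z; rewrite -(pclass_repr x) -(pclass_repr y) -(pclass_repr z).
by rewrite !pmulE catA.
Qed.

Lemma pmul1 : left_id pone pmul.
Proof. by move=> x; rewrite -(pclass_repr x) pmulE. Qed.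

Lemma pmulr1 : right_id pone pmul.
Proof. by move=> x; rewrite -(pclass_repr x) pmulE cats0. Qed.

Lemma pmulV : left_inverse pone pinv pmul.
Proof.
move=> x; rewrite -{2}(pclass_repr x) pmulE.
by apply/pclassP; apply: gword_eq_invl.
Qed.

Lemma pmulrV : right_inverse pone pinv pmul.
Proof.
move=> x; rewrite -{1}(pclass_repr x) pmulE.
by apply/pclassP; apply: gword_eq_invr.
Qed.

HB.instance Definition _ :=
  isGroup.Build presented pmulA pmul1 pmulr1 pmulV pmulrV.

Definition pgen (i : I) : presented := pclass [:: (i, false)].

Section Lift.

Variables (G : groupType) (g : I -> G).
Hypothesis g_rel : forall u v, rel u v -> gword_eval g u = gword_eval g v.

Lemma gword_evalP u v : gword_eq rel u v -> gword_eval g u = gword_eval g v.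
Proof.
elim=> {u v} [||u v w _ -> _ ->|u u' v v' _ uu' _ vv'|i b|] //.
- by rewrite /gword_eval !big_cat /= -!/(gword_eval _ _) uu' vv'.
- rewrite /gword_eval !big_cons big_nil /= mulg1.
  by case: b; rewrite /= ?mulgV ?mulVg.
Qed.

(* The morphism sending the generator [pgen i] to [g i]; it exists because [g]
   satisfies the defining relations. *)
Definition presented_lift of
    (forall u v, rel u v -> gword_eval g u = gword_eval g v) :=
  fun x : presented => gword_eval g (repr x).

Local Notation lift := (presented_lift g_rel).

Lemma presented_lift_class u : lift (pclass u) = gword_eval g u.
Proof. exact: gword_evalP (repr_pclass u). Qed.

Lemma presented_lift1 : lift 1%g = 1%g.
Proof. by rewrite presented_lift_class /gword_eval big_nil. Qed.

Lemma presented_liftM : {morph lift : x y / (x * y)%g}.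
Proof.
move=> x y; rewrite presented_lift_class /gword_eval big_cat.
by rewrite -!/(gword_eval _ _).
Qed.

HB.instance Definition _ :=
  isMultiplicative.Build presented G lift presented_liftM.
HB.instance Definition _ :=
  Multiplicative_isUMagmaMorphism.Build presented G lift presented_lift1.

Lemma presented_lift_gen i : lift (pgen i) = g i.
Proof. by rewrite presented_lift_class /gword_eval big_seq1. Qed.

End Lift.
End Presentation.

(* The generators s_1, ..., s_(n-1) are indexed from 0: [i : 'I_n.-1] is the
   index of s_(i+1). *)
Inductive twin_rel (n : nat) : gword 'I_n.-1 -> gword 'I_n.-1 -> Prop :=
| twin_rel_sq (i : 'I_n.-1) : twin_rel [:: (i, false); (i, false)] [::]
| twin_rel_comm (i j : 'I_n.-1) : (2 <= `|i - j|)%N ->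
    twin_rel [:: (i, false); (j, false)] [:: (j, false); (i, false)].

Definition twin (n : nat) := presented (@twin_rel n).
HB.instance Definition _ n := Group.on (twin n).

Definition twin_gen (n : nat) (i : 'I_n.-1) : twin n := pgen (@twin_rel n) i.

Local Open Scope ring_scope.

Local Notation "x %:F" := (@tofrac _ x).

(* Z[t, t^-1] is realised as the subring of the field of fractions Z(t) of
   Z[t] made of the fractions p / t^k. *)
Definition laurent_pred : {pred {fraction {poly int}}} :=
  fun x => `[< exists (p : {poly int}) (k : nat), x = p%:F / ('X^k)%:F >].

Lemma tofracXn_neq0 k : ('X^k : {poly int})%:F != 0.
Proof. by rewrite tofrac_eq0 expf_neq0 // polyX_eq0. Qed.

Lemma laurent_subring_closed : subring_closed laurent_pred.
Proof.
split=> [|x y /asboolP[p [k ->]] /asboolP[q [l ->]]|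
          x y /asboolP[p [k ->]] /asboolP[q [l ->]]]; apply/asboolP.
- by exists 1, 0%N; rewrite expr0 tofrac1 divr1.
- exists (p * 'X^l - q * 'X^k), (k + l)%N.
  rewrite exprD tofracB !tofracM -mulNr addf_div ?tofracXn_neq0 //.
  by rewrite mulNr.
- exists (p * q), (k + l)%N.
  by rewrite exprD !tofracM mulf_div.
Qed.

HB.instance Definition _ :=
  GRing.isSubringClosed.Build {fraction {poly int}} laurent_pred
    laurent_subring_closed.

Definition laurent := {x : {fraction {poly int}} | x \in laurent_pred}.
HB.instance Definition _ := SubChoice.on laurent.
HB.instance Definition _ := [SubChoice_isSubComNzRing of laurent by <:].

(* That these are exactly the invertible elements of [laurent] is the content
   of [laurent_mulVx] and [laurent_unitPl] below. *)
Definition laurent_unit : {pred laurent} :=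
  fun x => (val x != 0) && ((val x)^-1 \in laurent_pred).

Definition laurent_inv (x : laurent) : laurent :=
  if x \in laurent_unit then insubd x (val x)^-1 else x.

Lemma laurent_mulVx : {in laurent_unit, left_inverse 1 laurent_inv *%R}.
Proof.
move=> x ux; apply/val_inj; rewrite rmorphM rmorph1 /laurent_inv ux.
by case/andP: ux => x0 xV; rewrite /= insubdK // mulVf.
Qed.

Lemma laurent_unitPl (x y : laurent) : y * x = 1 -> laurent_unit x.
Proof.
move=> /(congr1 val); rewrite rmorphM rmorph1 /= => yx.
have x0 : val x != 0.
  by apply: contra_eq_neq yx => ->; rewrite mulr0 eq_sym oner_neq0.
apply/andP; split=> //.
suff -> : (val x)^-1 = val y by exact: valP.
by apply: (mulIf x0); rewrite mulVf.
Qed.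

Lemma laurent_invr_out : {in [predC laurent_unit], laurent_inv =1 id}.
Proof. by move=> x /negbTE ux; rewrite /laurent_inv ux. Qed.

HB.instance Definition _ := GRing.ComNzRing_hasMulInverse.Build laurent
  laurent_mulVx laurent_unitPl laurent_invr_out.

(* The library's ['GL_n[R]] only covers finite rings [R]. *)
Section GeneralLinear.

Variables (R : comUnitRingType) (n : nat).

Definition GL := {A : 'M[R]_n | A \in unitmx}.
HB.instance Definition _ := SubChoice.on GL.

Implicit Types A B C : GL.

Definition GL1 : GL := exist _ 1%:M (unitmx1 R n).
Lemma GLM_proof A B : val A *m val B \in unitmx.
Proof. by rewrite unitmx_mul (svalP A) (svalP B). Qed.
Definition GLM A B : GL := exist _ (val A *m val B) (GLM_proof A B).
Lemma GLV_proof A : invmx (val A) \in unitmx.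
Proof. by rewrite unitmx_inv (svalP A). Qed.
Definition GLV A : GL := exist _ (invmx (val A)) (GLV_proof A).

Lemma GLMA : associative GLM.
Proof. by move=> A B C; apply/val_inj; rewrite /= mulmxA. Qed.
Lemma GL1M : left_id GL1 GLM.
Proof. by move=> A; apply/val_inj; rewrite /= mul1mx. Qed.
Lemma GLM1 : right_id GL1 GLM.
Proof. by move=> A; apply/val_inj; rewrite /= mulmx1. Qed.
Lemma GLVM : left_inverse GL1 GLV GLM.
Proof. by move=> A; apply/val_inj; rewrite /= mulVmx // (svalP A). Qed.
Lemma GLMV : right_inverse GL1 GLV GLM.
Proof. by move=> A; apply/val_inj; rewrite /= mulmxV // (svalP A). Qed.

HB.instance Definition _ := isGroup.Build GL GLMA GL1M GLM1 GLVM GLMV.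

End GeneralLinear.

Section Eta2.

Variables (f : laurent) (n : nat).

(* With rows and columns indexed from 0, the block (0, f; f^-1, 0) attached to
   [i] occupies the rows and columns [i] and [i.+1]. *)
Definition eta2_mx (i : 'I_n.-1) : 'M[laurent]_n :=
  \matrix_(r, c)
    if (r == i :> nat) && (c == i.+1 :> nat) then f
    else if (r == i.+1 :> nat) && (c == i :> nat) then f^-1
    else ((r == c) && (r != i :> nat) && (r != i.+1 :> nat))%:R.

Hypothesis f_unit : f \is a GRing.unit.

Let lo (i : 'I_n.-1) : 'I_n := widen_ord (leq_pred n) i.

Fact hi_subproof (i : 'I_n.-1) : (i.+1 < n)%N.
Proof. by have := ltn_ord i; lia. Qed.
Let hi (i : 'I_n.-1) : 'I_n := Ordinal (hi_subproof i).

Let wt (i : 'I_n.-1) (r : 'I_n) : laurent :=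
  if r == i :> nat then f else if r == i.+1 :> nat then f^-1 else 1.

Lemma eta2_mxE i r c :
  eta2_mx i r c = wt i r * (c == tperm (lo i) (hi i) r)%:R.
Proof.
rewrite mxE /wt /lo /hi; case: tpermP => [->|->|/eqP rlo /eqP rhi].
- rewrite /= eqxx -(val_eqE c) /= andbF /=.
  have -> : (i == i.+1 :> nat) = false by lia.
  by case: eqP => _; rewrite ?mulr1 ?mulr0.
- have ii : (i.+1 == i :> nat) = false by lia.
  rewrite /= eqxx -(val_eqE c) /= ii andbF /=.
  by case: eqP => _; rewrite ?mulr1 ?mulr0.
- rewrite -!(inj_eq val_inj) /= in rlo rhi.
  rewrite (negbTE rlo) (negbTE rhi) /= !andbT mul1r.
  by rewrite eq_sym.
Qed.

Lemma eta2_mx_mulE i (A : 'M[laurent]_n) r c :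
  (eta2_mx i *m A) r c = wt i r * A (tperm (lo i) (hi i) r) c.
Proof.
rewrite mxE (bigD1 (tperm (lo i) (hi i) r)) //= big1 => [|k /negbTE kr].
  by rewrite eta2_mxE eqxx mulr1 addr0.
by rewrite eta2_mxE kr mulr0 mul0r.
Qed.

Lemma eta2_mx_sq i : eta2_mx i *m eta2_mx i = 1%:M.
Proof.
apply/matrixP => r c; rewrite eta2_mx_mulE eta2_mxE tpermK mulrA mxE.
rewrite (eq_sym c); suff -> : wt i r * wt i (tperm (lo i) (hi i) r) = 1.
  by rewrite mul1r.
have lohi : (i.+1 == i :> nat) = false by lia.
rewrite /wt /lo /hi; case: tpermP => [->|->|/eqP rlo /eqP rhi] /=.
- by rewrite !eqxx lohi divrr.
- by rewrite !eqxx lohi mulVr.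
- rewrite -!(inj_eq val_inj) /= in rlo rhi.
  by rewrite (negbTE rlo) (negbTE rhi) mulr1.
Qed.

Lemma eta2_mx_comm (i j : 'I_n.-1) : (2 <= `|i - j|)%N ->
  eta2_mx i *m eta2_mx j = eta2_mx j *m eta2_mx i.
Proof.
move=> ij; apply/matrixP => r c.
rewrite !eta2_mx_mulE !eta2_mxE !mulrA.
have wtE (k l : 'I_n.-1) (r' : 'I_n) : (2 <= `|k - l|)%N ->
    wt l (tperm (lo k) (hi k) r') = wt l r'.
  rewrite /wt /lo /hi => kl.
  have kl0 : (k == l :> nat) = false by lia.
  have kl1 : (k == l.+1 :> nat) = false by lia.
  have lk1 : (k.+1 == l :> nat) = false by lia.
  by case: tpermP => [->|->|//] /=; rewrite ?eqSS ?kl0 ?kl1 ?lk1.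
have perm_comm : tperm (lo j) (hi j) (tperm (lo i) (hi i) r) =
    tperm (lo i) (hi i) (tperm (lo j) (hi j) r).
  rewrite -!permM; congr (fun_of_perm _ _).
  have := @tpermJ _ (lo j) (hi j) (tperm (lo i) (hi i)).
  rewrite !tpermD -?(inj_eq val_inj) //=; try lia.
  by move=> cJ; rewrite -{1}cJ conjgE mulVKg.
rewrite !wtE //; last by lia.
by rewrite perm_comm [wt i r * _]mulrC.
Qed.

Lemma eta2_mx_unit i : eta2_mx i \in unitmx.
Proof. by have [] := mulmx1_unit (eta2_mx_sq i). Qed.

Definition eta2_gen (i : 'I_n.-1) : GL laurent n :=
  exist _ (eta2_mx i) (eta2_mx_unit i).

Lemma eta2_gen_rel u v :
  twin_rel u v -> gword_eval eta2_gen u = gword_eval eta2_gen v.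
Proof.
case=> [i|i j ij]; rewrite /gword_eval !big_cons !big_nil /= !mulg1;
  apply/val_inj => /=; [exact: eta2_mx_sq | exact: eta2_mx_comm].
Qed.

Definition eta2 : twin n -> GL laurent n := presented_lift eta2_gen_rel.
HB.instance Definition _ := UMagmaMorphism.on eta2.

Lemma eta2E i : val (eta2 (twin_gen i)) = eta2_mx i.
Proof. by rewrite /eta2 presented_lift_gen. Qed.

End Eta2.

Arguments eta2 f n f_unit _ : clear implicits.

(* Main.v *)
Require Import Defs.
From mathcomp Require Import all_boot all_order all_algebra.
From mathcomp Require Import perm zify.
Import GRing.Theory.
Local Open Scope ring_scope.

(** For [n = 2] the group is [{1, s}] and the image of [s] is a matrix with zero
    diagonal, so it is not the identity.

    For [n >= 3] the representation is too close to the permutation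
    representation to be faithful: conjugating by the diagonal matrix with
    entries [f ^- r] turns every [eta2_mx f i] into the matrix of the adjacent
    transposition [(i i+1)] ([eta2_mx_conj]). The images of [s_1] and [s_2]
    therefore inherit the braid relation [aba = bab] of the symmetric group
    ([eta2_braid]). The twin group does not satisfy it: all its relations
    preserve the parity of the number of occurrences of [s_1], which is even in
    [s_1 s_2 s_1] and odd in [s_2 s_1 s_2] ([twin_no_braid]). *)

Lemma twin_gen_sq (n : nat) (i : 'I_n.-1) :
  (twin_gen i * twin_gen i)%g = 1%g.
Proof.
rewrite [LHS](pmulE (@twin_rel n)).
by apply/pclassP/gword_eq_rel; constructor.
Qed.

Lemma pclass_cons (n : nat) (i : 'I_n.-1) b (w : gword 'I_n.-1) :
  pclass (@twin_rel n) ((i, b) :: w) =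
  (twin_gen i * pclass (@twin_rel n) w :> twin n)%g.
Proof.
have -> : pclass (@twin_rel n) ((i, b) :: w) =
    (pclass (@twin_rel n) [:: (i, b)] * pclass (@twin_rel n) w :> twin n)%g.
  by rewrite [RHS](pmulE (@twin_rel n)).
congr (_ * _)%g; case: b => //.
(* The remaining letter is a formal inverse; generators are involutions. *)
apply: (mulgI (twin_gen i)).
rewrite twin_gen_sq [LHS](pmulE (@twin_rel n)).
by apply/pclassP; apply: (gword_eq_cancel _ i false).
Qed.

Lemma twin2_elements (x : twin 2) : x = 1%g \/ x = twin_gen (ord0 : 'I_2.-1).
Proof.
rewrite -(pclass_repr x).
elim: (repr x) => [|[i b] w IHw]; first by left.
rewrite pclass_cons (ord1 i).
by case: IHw => ->; rewrite ?mulg1 ?twin_gen_sq; [right | left].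
Qed.

Lemma eta2_gen_neq1 (f : laurent) (n : nat) (f_unit : f \is a GRing.unit)
  (i : 'I_n.-1) : eta2 f n f_unit (twin_gen i) <> 1%g.
Proof.
have lt_in : (i < n)%N by have := ltn_ord i; lia.
move=> /(congr1 val); rewrite eta2E => /matrixP.
move=> /(_ (Ordinal lt_in) (Ordinal lt_in)); rewrite !mxE /= !eqxx /=.
have -> : (i == i.+1 :> nat) = false by lia.
by move/eqP; rewrite eq_sym oner_eq0.
Qed.

(** From index [i] to [i + 1] the diagonal entry [f ^- r] is multiplied by
    [f^-1], which cancels the coefficient [f] of [eta2_mx f i], and symmetrically
    from [i + 1] to [i]; only the permutation of the indices remains. *)
Lemma eta2_mx_conj (f : laurent) (n : nat) (f_unit : f \is a GRing.unit)
    (i : 'I_n.-1) (k l : 'I_n) : k = i :> nat -> l = i.+1 :> nat ->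
  let D := diag_mx (\row_(r < n) f^-1 ^+ r) in
  eta2_mx f i *m D = D *m tperm_mx k l.
Proof.
move=> ki li D; apply/matrixP => r c.
rewrite mul_mx_diag mul_diag_mx !mxE.
have ii : (i == i.+1 :> nat) = false by lia.
have ii' : (i.+1 == i :> nat) = false by lia.
case: tpermP => [->|->|/eqP rk /eqP rl].
- rewrite ki -(val_eqE l c) /= li eqxx ii /= andbF /= (eq_sym (c : nat)).
  case: eqP => [<-|_]; last by rewrite mul0r mulr0.
  by rewrite exprS mulrA divrr // mul1r mulr1.
- rewrite li -(val_eqE k c) /= ki eqxx ii' /= andbF /= (eq_sym (c : nat)).
  case: eqP => [<-|_]; last by rewrite mul0r mulr0.
  by rewrite exprS mulr1.
- move: rk rl; rewrite -!val_eqE /= ki li => /negbTE-> /negbTE->.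
  by rewrite /= !andbT; case: eqP => [->|_]; rewrite ?mul1r ?mulr1 ?mul0r ?mulr0.
Qed.

Lemma tperm_braid (T : finType) (x y z : T) : x != y -> y != z -> x != z ->
  (tperm x y * tperm y z * tperm x y = tperm y z * tperm x y * tperm y z)%g.
Proof.
move=> xy yz xz.
(* Both sides are conjugates, and both equal [tperm x z]. *)
have := tpermJ y z (tperm x y); have := tpermJ x y (tperm y z).
rewrite !conjgE !tpermV !mulgA tpermR tpermL.
rewrite (tpermD _ _ : tperm y z x = x) 1?(eq_sym _ x) //.
by rewrite (tpermD _ _ : tperm x y z = z) // => -> ->.
Qed.

Lemma eta2_braid (f : laurent) (n : nat) (f_unit : f \is a GRing.unit)
    (i j : 'I_n.-1) : j = i.+1 :> nat ->
  eta2 f n f_unit (twin_gen i * twin_gen j * twin_gen i)%g =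
  eta2 f n f_unit (twin_gen j * twin_gen i * twin_gen j)%g.
Proof.
move=> ji; apply/val_inj; rewrite !gmulfM /= !eta2E.
have lt0 : (i < n)%N by have := ltn_ord i; lia.
have lt1 : (i.+1 < n)%N by have := ltn_ord j; lia.
have lt2 : (i.+2 < n)%N by have := ltn_ord j; lia.
pose x := Ordinal lt0; pose y := Ordinal lt1; pose z := Ordinal lt2.
have iD := eta2_mx_conj f n f_unit i x y erefl erefl.
have jD := eta2_mx_conj f n f_unit j y z (esym ji) (esym (congr1 succn ji)).
move: iD jD => /=; set D := diag_mx _ => iD jD.
have Du : D \in unitmx.
  rewrite unitmxE det_diag unitr_prod // => r _.
  by rewrite mxE unitrX // unitrV.
apply: (can_inj (mulmxK Du)).
rewrite -!mulmxA !(iD, jD) !(mulmxA _ D) !(iD, jD) -!(mulmxA D).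
rewrite !(mulmxA _ D) !(iD, jD) -!(mulmxA D) /tperm_mx -!perm_mxM.
by rewrite !mulgA tperm_braid // -val_eqE /=; lia.
Qed.

(** The parity of the number of occurrences of [twin_gen i] is a morphism to the
    group of order two, realised as the permutations of [bool]; it separates the
    two sides of the braid relation. *)
Lemma twin_no_braid (n : nat) (i j : 'I_n.-1) : i != j ->
  (twin_gen i * twin_gen j * twin_gen i)%g <>
  (twin_gen j * twin_gen i * twin_gen j)%g.
Proof.
move=> ij.
pose g (k : 'I_n.-1) : {perm bool} := if k == i then tperm true false else 1%g.
have g_rel u v : @twin_rel n u v -> gword_eval g u = gword_eval g v.
  case=> [k|k l _]; rewrite /gword_eval !big_cons !big_nil /= !mulg1 /g.
    by case: ifP; rewrite ?tperm2 ?mulg1.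
  by do 2 case: ifP; rewrite ?mulg1 ?mul1g.
move=> /(congr1 (presented_lift g_rel)).
rewrite !presented_liftM !presented_lift_gen /g eqxx (eq_sym j) (negbTE ij).
rewrite mulg1 mul1g mulg1 tperm2 => /(congr1 (fun s : {perm bool} => s true)).
by rewrite perm1 tpermL.
Qed.

Theorem theorem17 (f : laurent) (f_unit : f \is a GRing.unit) :
  injective (eta2 f 2 f_unit) /\
  (forall n : nat, (3 <= n)%N -> ~ injective (eta2 f n f_unit)).
Proof.
split=> [x y|n n3 inj].
  have s_neq1 := eta2_gen_neq1 f 2 f_unit ord0.
  case: (twin2_elements x) => ->; case: (twin2_elements y) => -> //;
    rewrite gmulf1 => eq_s; case: s_neq1; exact: eq_s || exact: esym.
have lt0 : (0 < n.-1)%N by lia.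
have lt1 : (1 < n.-1)%N by lia.
apply: (@twin_no_braid n (Ordinal lt0) (Ordinal lt1)) => //.
exact/inj/eta2_braid.
Qed.
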